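(* Let $G$ be a graph with no isolated vertices. The following three statements are equivalent: (i) $G$ is a triangle-free WTD(2) graph. (ii) $G$ is a bipartite WTD(2) graph. (iii) $G$ is a complete bipartite graph, or $G$ is a bipartite graph with parts $X$ and $Y$ such that there exist vertices $a\in X\setminus X_u$ and $b\in Y\setminus Y_u$ satisfying $N(a)=Y_u\neq\emptyset$ and $N(b)=X_u\neq\emptyset$.
   Context: Graphs are finite, simple and nonempty. A total dominating set (TDS) of a graph $G$ with no isolated vertices is a set $S\subseteq V(G)$ such that every vertex of $G$ is adjacent to at least one element of $S$; it is minimal if it contains no other TDS. $\gamma_t(G)$ is the minimum size of a TDS. $G$ is well-totally-dominated (WTD) if all its minimal TDSs have the same size. A WTD(2) graph is a WTD graph with $\gamma_t(G)=2$. $N(v)$ is the open neighborhood of $v$. For a bipartite graph with parts $X$ and $Y$, define $X_u=\{x\in X: N(x)=Y\}$ and $Y_u=\{y\in Y: N(y)=X\}$, i.e. $X_u$ (resp. $Y_u$) is the set of vertices in $X$ (resp. $Y$) adjacent to every vertex in $Y$ (resp. $X$). *)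

(* Defs.v *)
(* MathComp. A finite simple graph is a symmetric irreflexive relation
   [e : rel T] on [T : finType]. *)
From mathcomp Require Import all_boot.

Set Implicit Arguments.
Unset Strict Implicit.
Unset Printing Implicit Defensive.

Section Graph.
Variables (T : finType) (e : rel T).

Definition open_nbhd (v : T) : {set T} := [set w | e v w].

Definition no_isolated : Prop := forall v : T, open_nbhd v != set0.

Definition tds (S : {set T}) : bool := [forall v, exists u in S, e v u].

Definition minimal_tds (S : {set T}) : bool := minset tds S.

(* [setT] is total dominating when no vertex is isolated; the value is
   meaningful only in that case. *)
Definition gamma_t : nat := #|[arg min_(S < [set: T] | tds S) #|S|]|.

Definition wtd : Prop :=
  forall S1 S2 : {set T}, minimal_tds S1 -> minimal_tds S2 -> #|S1| = #|S2|.

Definition wtd2 : Prop := wtd /\ gamma_t = 2.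

Definition triangle_free : Prop :=
  ~ exists x y z : T, [/\ e x y, e y z & e x z].

Definition bipartition (X Y : {set T}) : Prop :=
  [/\ X :|: Y = [set: T], [disjoint X & Y] &
      forall u v, e u v -> (u \in X /\ v \in Y) \/ (u \in Y /\ v \in X)].

Definition bipartite : Prop := exists X Y : {set T}, bipartition X Y.

Definition complete_bipartite : Prop :=
  exists X Y : {set T}, bipartition X Y /\ {in X & Y, forall x y, e x y}.

(* X_u is [full_part X Y] and Y_u is [full_part Y X]. *)
Definition full_part (X Y : {set T}) : {set T} :=
  [set x in X | open_nbhd x == Y].

End Graph.

(* Main.v *)
Require Import Defs.
From mathcomp Require Import all_boot.

Set Implicit Arguments.
Unset Strict Implicit.
Unset Printing Implicit Defensive.

(* A total dominating set of size 2 is an edge xy with N(x) and N(y) covering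
   the graph: if there are no triangles, N(y) and N(x) are the two parts of a
   bipartition, and in a bipartite graph with parts X, Y one has N(x) = Y and
   N(y) = X, i.e. x is in X_u and y is in Y_u.  So a bipartite graph is WTD(2)
   iff every total dominating set meets both X_u and Y_u.  The complement of
   Y_u fails to be total dominating exactly when some vertex has all its
   neighbours in Y_u; such a vertex a lies in X, and N(a) = Y_u since Y_u is
   contained in the neighbourhood of every vertex of X. *)

Section Graph.
Variables (T : finType) (e : rel T).
Implicit Types (S X Y : {set T}) (u v x y : T).

Lemma tdsP S : reflect (forall v, exists2 u, u \in S & e v u) (tds e S).
Proof.
apply: (iffP forallP) => H v.
  by have /existsP[u /andP[uS evu]] := H v; exists u.
by have [u uS evu] := H v; apply/existsP; exists u; rewrite uS.
Qed.

Lemma bipartitionC X Y : bipartition e X Y -> bipartition e Y X.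
Proof.
case=> cov dis edg; split; first by rewrite setUC.
  by rewrite disjoint_sym.
by move=> u v /edg [] ?; [right | left].
Qed.

Lemma bipartition_adj X Y u v :
  bipartition e X Y -> e u v -> u \in X -> v \in Y.
Proof.
case=> _ dis edg /edg [[]//|[uY _] uX].
by rewrite (disjointFr dis uX) in uY.
Qed.

Lemma bipartition_mem X Y u : bipartition e X Y -> u \in X \/ u \in Y.
Proof.
by case=> cov _ _; apply/setUP; rewrite cov inE.
Qed.

Lemma full_partP X Y x : bipartition e X Y ->
  reflect (x \in X /\ {in Y, forall y, e x y}) (x \in full_part e X Y).
Proof.
move=> bip; rewrite inE; apply: (iffP andP) => -[xX].
  by move/eqP=> Nx; split=> // y; rewrite -Nx inE.
move=> full; split=> //; apply/eqP/setP=> y; rewrite inE.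
by apply/idP/idP => [/bipartition_adj|/full//]; apply; eassumption.
Qed.

Hypothesis esym : symmetric e.

Lemma bipartite_triangle_free : bipartite e -> triangle_free e.
Proof.
move=> [X [Y bip]].
(* The parts are kept general so that the same walk also covers a triangle starting in [Y]: two
   steps return [z] to the part of [x], which the edge [xz] forbids. *)
have contra A B x y z : bipartition e A B -> x \in A -> e x y -> e y z ->
    e x z -> False.
  move=> bAB xA exy eyz exz.
  have yB := bipartition_adj bAB exy xA.
  have zA := bipartition_adj (bipartitionC bAB) eyz yB.
  have xB := bipartition_adj bAB (etrans (esym z x) exz) zA.
  by case: bAB => _ dis _; rewrite (disjointFr dis xA) in xB.
move=> [x [y [z [exy eyz exz]]]].
case: (bipartition_mem x bip) => xin.
  exact: contra bip xin exy eyz exz.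
exact: contra (bipartitionC bip) xin exy eyz exz.
Qed.

Lemma full_part_tds X Y x y : bipartition e X Y ->
  x \in full_part e X Y -> y \in full_part e Y X -> tds e [set x; y].
Proof.
move=> bip /(full_partP _ bip)[_ fx] /(full_partP _ (bipartitionC bip))[_ fy].
apply/tdsP=> v; case: (bipartition_mem v bip) => vin.
  by exists y; rewrite ?set22 // esym fy.
by exists x; rewrite ?set21 // esym fx.
Qed.

Hypothesis eirr : irreflexive e.

Lemma tds_pair S : tds e S -> #|S| = 2 ->
  exists x y, [/\ S = [set x; y], e x y & forall v, e v x \/ e v y].
Proof.
move=> /[swap] /eqP/cards2P[x [y [_ ->]]] /tdsP tdS; exists x, y; split=> //.
  (* The dominator of [x] within the pair cannot be [x] itself, so it is [y]. *)
  by have [u /set2P[]->] := tdS x; rewrite ?eirr.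
by move=> v; have [u /set2P[]->] := tdS v; [left | right].
Qed.

(** Converse to [full_part_tds]: a vertex in the part of [y] cannot be adjacent to [y], so it must
    be dominated by [x], and symmetrically. *)
Lemma tds_pair_full X Y S : bipartition e X Y -> tds e S -> #|S| = 2 ->
  exists x y,
    [/\ S = [set x; y], x \in full_part e X Y & y \in full_part e Y X].
Proof.
move=> bip tdS cS; have [x [y [defS exy dom]]] := tds_pair tdS cS.
have bip' := bipartitionC bip.
have full A B u v : bipartition e A B -> u \in A -> v \in B ->
    (forall w, e w u \/ e w v) -> u \in full_part e A B.
  move=> bAB uA vB domuv; apply/(full_partP _ bAB); split=> // w wB.
  rewrite esym; case: (domuv w) => // ewv.
  have := bipartition_adj (bipartitionC bAB) ewv wB.
  by case: bAB => _ dis _; rewrite (disjointFl dis vB).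
have domC w : e w y \/ e w x by case: (dom w); [right | left].
case: (bip) => _ _ /(_ _ _ exy) [[xX yY]|[xY yX]].
  by exists x, y; split=> //; apply: full; eassumption.
by exists y, x; split; [rewrite setUC | apply: full; eassumption ..].
Qed.

Hypothesis noiso : no_isolated e.

Lemma neighbour v : exists u, e v u.
Proof. by have /set0Pn[u] := noiso v; rewrite inE; exists u. Qed.

Lemma tds_setT : tds e [set: T].
Proof. by apply/tdsP=> v; have [u evu] := neighbour v; exists u. Qed.

Lemma gamma_t_witness :
  exists S, [/\ minimal_tds e S, tds e S & #|S| = gamma_t e].
Proof.
rewrite /gamma_t; case: arg_minnP => [|S tdS minS]; first exact: tds_setT.
exists S; split=> //; apply/minsetP; split=> // B tdB sBS.
by apply/eqP; rewrite eqEcard sBS minS.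
Qed.

(** A total dominating set of least size is also minimal for inclusion, so [gamma_t] is itself the
    size of some minimal one. *)
Lemma wtd2P : wtd2 e <-> forall S, minimal_tds e S -> #|S| = 2.
Proof.
have [S0 [minS0 _ cS0]] := gamma_t_witness; split.
  by case=> w g S minS; rewrite (w _ _ minS minS0) cS0.
move=> all2; split; last by rewrite -cS0 all2.
by move=> S1 S2 /all2-> /all2->.
Qed.

Lemma triangle_free_wtd2_bipartite : triangle_free e -> wtd2 e -> bipartite e.
Proof.
move=> tf [_ g2]; have [S [_ tdS]] := gamma_t_witness; rewrite g2.
move=> /(tds_pair tdS)[x [y [_ exy dom]]].
exists (open_nbhd e y), (open_nbhd e x); split.
- by apply/setP=> v; rewrite !inE ![e _ v]esym; case: (dom v) => -> //; rewrite orbT.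
- rewrite disjoint_subset; apply/subsetP=> v; rewrite !inE => eyv.
  by apply/negP=> exv; apply: tf; exists x, y, v.
move=> u v euv; rewrite !inE ![e _ u]esym ![e _ v]esym.
(* If the ends of an edge were both adjacent to [x], or both to [y], they would form a triangle with
   it. *)
case: (dom u) => eu; case: (dom v) => ev; [|by right|by left|].
  by case: tf; exists u, v, x.
by case: tf; exists u, v, y.
Qed.

(** Dominating [a] and [b] forces any total dominating set to meet both [Y_u] and [X_u]. The two
    vertices found there already dominate everything, so a minimal set consists of just them. *)
Lemma wtd2_of_full_nbhd X Y a b : bipartition e X Y ->
  open_nbhd e a = full_part e Y X -> open_nbhd e b = full_part e X Y -> wtd2 e.
Proof.
move=> bip Na Nb; apply/wtd2P => S /minsetP[tdS minS].
have [y yS] := tdsP _ tdS a; have [x xS] := tdsP _ tdS b.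
have -> : e b x = (x \in open_nbhd e b) by rewrite inE.
have -> : e a y = (y \in open_nbhd e a) by rewrite inE.
rewrite Na Nb => xU yU.
rewrite -(minS [set x; y]); first 1 last.
- exact: full_part_tds xU yU.
- by apply/subsetP=> z /set2P[]->.
rewrite cards2; case: eqP => // exy; subst y.
case: bip => _ dis _; case/setIdP: xU => xX _; case/setIdP: yU => xY _.
by rewrite (disjointFr dis xX) in xY.
Qed.

(** Here [X_u] is [X] and [Y_u] is [Y], so any [x] in [X] and [y] in [Y] can serve as [a] and [b];
    the ends of any edge supply such a pair. *)
Lemma complete_bipartite_wtd2 :
  0 < #|T| -> complete_bipartite e -> wtd2 e.
Proof.
move=> /card_gt0P[v _] [X [Y [bip full]]]; have bip' := bipartitionC bip.
have [x [y [xX yY]]] : exists x y, x \in X /\ y \in Y.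
  have [u evu] := neighbour v.
  by case: bip => _ _ /(_ _ _ evu) [[]|[]]; [exists v, u | exists u, v].
have fX z : z \in X -> z \in full_part e X Y.
  by move=> zX; apply/full_partP=> //; split=> // w; apply: full.
have fY z : z \in Y -> z \in full_part e Y X.
  by move=> zY; apply/full_partP=> //; split=> // w wX; rewrite esym full.
apply: (@wtd2_of_full_nbhd X Y x y bip); apply/setP=> z; apply/idP/idP.
- by rewrite inE => /bipartition_adj-/(_ _ _ bip xX)/fY.
- by case/setIdP=> zY _; rewrite inE full.
- by rewrite inE => /bipartition_adj-/(_ _ _ bip' yY)/fX.
- by case/setIdP=> zX _; rewrite inE esym full.
Qed.

Lemma full_nbhd_of_wtd2 X Y : bipartition e X Y -> wtd2 e ->
  exists2 a, a \in X & open_nbhd e a = full_part e Y X.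
Proof.
move=> bip /wtd2P all2; have bip' := bipartitionC bip.
(* Otherwise the complement would contain a minimal total dominating set; having size 2, that set
   includes a vertex of [Y_u]. *)
have ntd : ~~ tds e (~: full_part e Y X).
  apply/negP=> /minset_exists[S minS sS].
  have tdS : tds e S by case/minsetP: minS.
  have [x [y [defS _ yU]]] := tds_pair_full bip tdS (all2 _ minS).
  by have /subsetP/(_ y) := sS; rewrite defS set22 in_setC yU => /(_ isT).
have [a Na] : exists a, forall u, e a u -> u \in full_part e Y X.
  move: ntd; rewrite negb_forall => /existsP[a]; rewrite negb_exists.
  move/forallP=> H; exists a => u eau; have := H u.
  by rewrite eau andbT in_setC negbK.
(* Since [a] is not isolated, it has a neighbour in [Y_u], hence in [Y]. *)
have aX : a \in X.
  have [u eau] := neighbour a; have /setIdP[uY _] := Na _ eau.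
  by apply: (bipartition_adj bip' _ uY); rewrite esym.
exists a => //; apply/setP=> u; rewrite [LHS]inE; apply/idP/idP => [/Na//|].
by move=> /(full_partP _ bip')[_ /(_ a aX)]; rewrite esym.
Qed.

(** If [a] were in [X_u], then [Y = N(a) = Y_u], making the graph complete bipartite. *)
Lemma full_nbhd_not_full X Y a : bipartition e X Y ->
  ~~ [forall x in X, forall y in Y, e x y] ->
  a \in X -> open_nbhd e a = full_part e Y X -> a \in X :\: full_part e X Y.
Proof.
move=> bip ncb aX Na; rewrite in_setD aX andbT.
apply: contra ncb => /setIdP[_ /eqP NaY].
apply/forall_inP=> x xX; apply/forall_inP=> y.
rewrite -NaY Na => /(full_partP _ (bipartitionC bip))[_ /(_ x xX)].
by rewrite esym.
Qed.

End Graph.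

Theorem theorem3p8 (T : finType) (e : rel T)
    (nonempty : 0 < #|T|) (esym : symmetric e) (eirr : irreflexive e)
    (noiso : no_isolated e) :
  (triangle_free e /\ wtd2 e <-> bipartite e /\ wtd2 e) /\
  (bipartite e /\ wtd2 e <->
     complete_bipartite e \/
     exists X Y : {set T},
       bipartition e X Y /\
       exists a b : T,
         [/\ a \in X :\: full_part e X Y,
             b \in Y :\: full_part e Y X,
             open_nbhd e a = full_part e Y X /\ full_part e Y X <> set0 &
             open_nbhd e b = full_part e X Y /\ full_part e X Y <> set0]).
Proof.
split; split.
- by case=> tf w; split=> //; apply: triangle_free_wtd2_bipartite.
- by case=> bip w; split=> //; apply: bipartite_triangle_free.
- case=> -[X [Y bip]] w; have bip' := bipartitionC bip.
  have [full|ncb] := boolP [forall x in X, forall y in Y, e x y].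
    left; exists X, Y; split=> // x y xX yY.
    by move/forall_inP: full => /(_ x xX)/forall_inP/(_ y yY).
  have ncb' : ~~ [forall y in Y, forall x in X, e y x].
    apply: contra ncb => /forall_inP full; apply/forall_inP=> x xX.
    apply/forall_inP=> y yY; rewrite esym.
    by move/forall_inP: (full y yY) => /(_ x xX).
  have [a aX Na] := full_nbhd_of_wtd2 esym eirr noiso bip w.
  have [b bY Nb] := full_nbhd_of_wtd2 esym eirr noiso bip' w.
  right; exists X, Y; split=> //; exists a, b; split.
  + exact: full_nbhd_not_full.
  + exact: full_nbhd_not_full.
  (* [Y_u] is nonempty because it is the neighbourhood of the non-isolated vertex [a]. *)
  + by split=> //; apply/eqP; rewrite -Na noiso.
  + by split=> //; apply/eqP; rewrite -Nb noiso.
- case=> [cb|[X [Y [bip [a [b [_ _ [Na _] [Nb _]]]]]]]].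
    split; last exact: complete_bipartite_wtd2.
    by case: cb => X [Y [bip _]]; exists X, Y.
  by split; [exists X, Y | apply: wtd2_of_full_nbhd Na Nb].
Qed.
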